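(* Let $n\in\mathbb{N}$ and $M\in\mathbb{R}^{n\times n}$. Then: (a) $M\in S_n$ if and only if $1_n^T M u = 0 = u^T M 1_n$ for all $u\in\{1_n\}^\bot$; (b) $M\in A_n$ if and only if $M+\mathcal{J}_n M\mathcal{J}_n=\mathcal{O}_n$; (c) $M\in B_n$ if and only if $M=\mathcal{J}_n M\mathcal{J}_n$; (d) $M\in R_n$ if and only if $(M+M\mathcal{J}_n)u=0$ and $(M^T+M^T\mathcal{J}_n)u=0$ for all $u\in\{1_n\}^\bot$; these two conditions are equivalent to $(M^T+\mathcal{J}_n M^T)\mathbb{R}^n\subset\mathbb{R}1_n$ and $(M+\mathcal{J}_n M)\mathbb{R}^n\subset\mathbb{R}1_n$, respectively; (e) $M\in V_n$ if and only if $u^T M v=0$ for all $u,v\in\{1_n\}^\bot$ and $1_n^T M 1_n=0$; (f) if $n$ is even, then $M\in M_n$ if and only if $u^T M v=0$ for all $u,v\in\{\sigma_n\}^\bot$ and $\sigma_n^T M\sigma_n=0$; (g) if $n$ is even, then $M\in N_n$ if and only if $\sigma_n^T M u=0=u^T M\sigma_n$ for all $u\in\{\sigma_n\}^\bot$.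
   Context: Matrix indices are taken in $\mathbb{Z}_n=\mathbb{Z}/n\mathbb{Z}$ (computed modulo $n$), the top left entry having index $(1,1)$. Vectors are columns; $1_n\in\mathbb{R}^n$ is the all-ones vector; $\sigma_n\in\mathbb{R}^n$ is the alternating vector with $j$th entry $(-1)^{j-1}$, $j=1,\dots,n$; $\mathcal{O}_n$ is the $n\times n$ null matrix; $\mathcal{J}_n=(\delta_{i,n+1-j})_{i,j=1}^n$ has ones on the antidiagonal and zeros elsewhere; $X^\bot=\{u\in\mathbb{R}^n\mid u^Tv=0\ (v\in X)\}$. The spaces of matrices $M\in\mathbb{R}^{n\times n}$ are defined as follows. $S_n$: there is $w\in\mathbb{R}$ (the weight) such that $\sum_{j\in\mathbb{Z}_n}M_{i,j}=\sum_{j\in\mathbb{Z}_n}M_{j,i}=nw$ for all $i\in\mathbb{Z}_n$. $A_n$: $M_{i,j}+M_{n+1-i,n+1-j}=0$ for all $i,j$. $B_n$: $M_{i,j}-M_{n+1-i,n+1-j}=0$ for all $i,j$. $R_n$: $M_{i,j}+M_{i,n+1-j}=M_{i,k}+M_{i,n+1-k}$ and $M_{i,j}+M_{n+1-i,j}=M_{k,j}+M_{n+1-k,j}$ for all $i,j,k$. $V_n$: $M_{i,j}+M_{k,l}=M_{i,l}+M_{k,j}$ for all $i,j,k,l$, and $\sum_{i,j=1}^nM_{i,j}=0$. For even $n$: $M_n$: $M_{i,j}+M_{i,j+1}+M_{i+1,j}+M_{i+1,j+1}=0$ for all $i,j\in\mathbb{Z}_n$, and $\sum_{i,j\in\mathbb{Z}_n}(-1)^{i+j}M_{i,j}=0$.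 $N_n$: $\sum_{i\in\mathbb{Z}_n}(-1)^i(M_{i,j}+M_{i,j+1})=\sum_{i\in\mathbb{Z}_n}(-1)^i(M_{j,i}+M_{j+1,i})=0$ for all $j\in\mathbb{Z}_n$. *)

(* Defs.v *)
From HB Require Import structures.
From mathcomp Require Import all_boot all_order all_algebra.
From mathcomp Require Import classical_sets reals.

Set Implicit Arguments.
Unset Strict Implicit.
Unset Printing Implicit Defensive.

Import Order.TTheory GRing.Theory Num.Theory.
Local Open Scope classical_set_scope.
Local Open Scope ring_scope.

(* Rows and columns are classically numbered 1, ..., n with indices read
   modulo n; the ordinal i : 'I_n stands for the index i + 1.  Hence
   [rev_ord i] stands for n + 1 - (index of i), [ordS i] for the cyclic
   successor, and the sign (-1)^(index of i) is (-1) ^+ i.+1. *)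

Section Vectors.
Variables (R : realType) (n : nat).
Implicit Types (u v : 'cV[R]_n) (X : set 'cV[R]_n).

Definition ones : 'cV[R]_n := const_mx 1.

(* The j-th entry is (-1)^(j-1) for the index j in 1, ..., n. *)
Definition alt : 'cV[R]_n := \col_(j < n) (-1) ^+ j.

Definition exchange_mx : 'M[R]_n :=
  \matrix_(i < n, j < n) (i == rev_ord j)%:R.

Definition orth X : set 'cV[R]_n :=
  [set u | forall v, X v -> u^T *m v = 0].

Definition line v : set 'cV[R]_n := [set c *: v | c in [set: R]].

Definition col_range (A : 'M[R]_n) : set 'cV[R]_n :=
  [set A *m x | x in [set: 'cV[R]_n]].

End Vectors.

Arguments ones {R n}.
Arguments alt {R n}.
Arguments exchange_mx {R n}.

Section Spaces.
Variables (R : realType) (n : nat).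

Definition space_S : set 'M[R]_n :=
  [set M | exists w : R, forall i : 'I_n,
     \sum_(j < n) M i j = n%:R * w /\ \sum_(j < n) M j i = n%:R * w].

Definition space_A : set 'M[R]_n :=
  [set M | forall i j : 'I_n, M i j + M (rev_ord i) (rev_ord j) = 0].

Definition space_B : set 'M[R]_n :=
  [set M | forall i j : 'I_n, M i j - M (rev_ord i) (rev_ord j) = 0].

Definition space_R : set 'M[R]_n :=
  [set M | forall i j k : 'I_n,
     M i j + M i (rev_ord j) = M i k + M i (rev_ord k) /\
     M i j + M (rev_ord i) j = M k j + M (rev_ord k) j].

Definition space_V : set 'M[R]_n :=
  [set M | (forall i j k l : 'I_n, M i j + M k l = M i l + M k j) /\
           \sum_(i < n) \sum_(j < n) M i j = 0].

(* [space_M] and [space_N] are meant for even n only: otherwise the sign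
   is not well defined on indices modulo n. *)
Definition space_M : set 'M[R]_n :=
  [set M | (forall i j : 'I_n,
              M i j + M i (ordS j) + M (ordS i) j + M (ordS i) (ordS j) = 0) /\
           \sum_(i < n) \sum_(j < n) (-1) ^+ (i.+1 + j.+1) * M i j = 0].

Definition space_N : set 'M[R]_n :=
  [set M | forall j : 'I_n,
     \sum_(i < n) (-1) ^+ i.+1 * (M i j + M i (ordS j)) = 0 /\
     \sum_(i < n) (-1) ^+ i.+1 * (M j i + M (ordS j) i) = 0].

End Spaces.

(* Main.v *)
(* The hyperplane orthogonal to a vector t with entries +1 and -1 is spanned
   by the vectors t_j e_j - t_k e_k, so that each vanishing condition on the
   hyperplane says that some t_j a_j does not depend on j.  For even n the
   vector [alt] changes sign under the cyclic shift of the indices, which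
   turns the defining relations of M_n and N_n into the invariance of such
   an expression under the shift. *)
Require Import Defs.
From HB Require Import structures.
From mathcomp Require Import all_boot all_order all_algebra.
From mathcomp Require Import classical_sets reals.
From mathcomp Require Import lra.

Set Implicit Arguments.
Unset Strict Implicit.
Unset Printing Implicit Defensive.

Import Order.TTheory GRing.Theory Num.Theory.
Local Open Scope classical_set_scope.
Local Open Scope ring_scope.

Lemma orth1P (R : realType) n (t u : 'cV[R]_n) :
  orth [set t] u <-> \sum_j u j 0 * t j 0 = 0.
Proof.
have E : (u^T *m t) 0 0 = \sum_j u j 0 * t j 0.
  by rewrite mxE; apply: eq_bigr => j _; rewrite mxE.
split=> [/(_ t erefl) ut0|ut0 v ->]; first by rewrite -E ut0 mxE.
by apply/matrixP => i j; rewrite !ord1 E ut0 mxE.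
Qed.

(** * Forms vanishing on the hyperplane orthogonal to a sign vector *)

Section SignVector.
Variables (R : realType) (n : nat) (t : 'cV[R]_n).
Hypothesis t_sq : forall j, t j 0 * t j 0 = 1.

(** Both sides say that every row of [A] is a multiple of [t^T]: since [t j 0] is its own inverse,
    the factor is the common value [A i k * t k 0]. *)
Lemma kill_orthP m (A : 'M[R]_(m, n)) :
  (forall u : 'cV[R]_n, orth [set t] u -> A *m u = 0) <->
  (forall i j k, A i j * t j 0 = A i k * t k 0).
Proof.
split=> [A0 i j k|At u /orth1P ut0].
  pose u : 'cV[R]_n := t j 0 *: delta_mx j 0 - t k 0 *: delta_mx k 0.
  have sumE (a : 'I_n -> R) :
      \sum_l a l * u l 0 = a j * t j 0 - a k * t k 0.
    have sum_delta h : \sum_l a l * (t h 0 * (l == h)%:R) = a h * t h 0.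
      rewrite (bigD1 h) //= eqxx mulr1 big1 ?addr0 // => l /negPf ->.
      by rewrite !mulr0.
    rewrite -(sum_delta j) -(sum_delta k) -sumrB; apply: eq_bigr => l _.
    by rewrite !mxE eqxx !andbT -mulrBr.
  have /A0/matrixP/(_ i 0) : orth [set t] u.
    apply/orth1P; under eq_bigr do rewrite mulrC.
    by rewrite sumE !t_sq subrr.
  by rewrite !mxE sumE => /eqP; rewrite subr_eq0 => /eqP.
apply/matrixP => i o; rewrite ord1 !mxE.
(* Naming the common value takes a reference index; if there is none, the sum is empty. *)
case: (pickP (@predT 'I_n)) => [k _|n0]; last first.
  by rewrite big1 // => j; have := n0 j.
transitivity (A i k * t k 0 * \sum_j u j 0 * t j 0); last first.
  by rewrite ut0 mulr0.
rewrite mulr_sumr; apply: eq_bigr => j _.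
by rewrite -(At i j k) mulrACA t_sq mulr1.
Qed.

(** [kill_orthP] is used twice. For fixed [u] it compares the entries [j] and [l] of [u^T *m M];
    their signed difference is linear in [u], with coefficient row [B j l], which must again vanish
    on the hyperplane. *)
Lemma bilinear_orthP (M : 'M[R]_n) :
  (forall u v : 'cV[R]_n, orth [set t] u -> orth [set t] v ->
     u^T *m M *m v = 0) <->
  (forall i j k l, (M i j * t j 0 - M i l * t l 0) * t i 0 =
                   (M k j * t j 0 - M k l * t l 0) * t k 0).
Proof.
pose B j l : 'rV[R]_n := \row_i (M i j * t j 0 - M i l * t l 0).
have BE j l (u : 'cV[R]_n) : (B j l *m u) 0 0 =
    (u^T *m M) 0 j * t j 0 - (u^T *m M) 0 l * t l 0.
  rewrite !mxE !mulr_suml -sumrB; apply: eq_bigr => i _.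
  by rewrite !mxE mulrBl mulrC mulrA [in X in _ - X]mulrC mulrA.
split=> [M0 i j k l|Mt u v ut].
  suff /kill_orthP/(_ 0 i k) :
    forall u : 'cV[R]_n, orth [set t] u -> B j l *m u = 0 by rewrite !mxE.
  move=> u ut; apply/matrixP => a b; rewrite !ord1 BE [RHS]mxE.
  apply/eqP; rewrite subr_eq0; apply/eqP.
  by move/kill_orthP: (M0 u ^~ ut); apply.
apply: (kill_orthP (u^T *m M)).2 => i j l; rewrite ord1.
apply/eqP; rewrite -subr_eq0 -BE.
rewrite (kill_orthP _).2 ?mxE // => a h k; rewrite !mxE; exact: Mt.
Qed.

Lemma quadratic_formE (M : 'M[R]_n) :
  (t^T *m M *m t) 0 0 = \sum_i \sum_j t i 0 * t j 0 * M i j.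
Proof.
rewrite mxE exchange_big; apply: eq_bigr => j _; rewrite mxE mulr_suml.
by apply: eq_bigr => i _; rewrite mxE mulrAC.
Qed.

(** [kill_orthP] applies to the rows [t^T *m M] and [t^T *m M^T], the second condition being read
    through its transpose. *)
Lemma linear_orthP (M : 'M[R]_n) :
  (forall u : 'cV[R]_n, orth [set t] u ->
     t^T *m M *m u = 0 /\ u^T *m M *m t = 0) <->
  (forall j k,
     (\sum_i t i 0 * M i j) * t j 0 = (\sum_i t i 0 * M i k) * t k 0 /\
     (\sum_i t i 0 * M j i) * t j 0 = (\sum_i t i 0 * M k i) * t k 0).
Proof.
have rowE (N : 'M[R]_n) j : (t^T *m N) 0 j = \sum_i t i 0 * N i j.
  by rewrite mxE; apply: eq_bigr => i _; rewrite mxE.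
have colE j : (t^T *m M^T) 0 j = \sum_i t i 0 * M j i.
  by rewrite rowE; apply: eq_bigr => i _; rewrite mxE.
have trE (u : 'cV[R]_n) : t^T *m M^T *m u = (u^T *m M *m t)^T.
  by rewrite !trmx_mul trmxK mulmxA.
split=> [M0 j k|Mt u ut].
  split.
    have /kill_orthP/(_ 0 j k) :
      forall u : 'cV[R]_n, orth [set t] u -> t^T *m M *m u = 0.
      by move=> u /M0[].
    by rewrite !rowE.
  have /kill_orthP/(_ 0 j k) :
    forall u : 'cV[R]_n, orth [set t] u -> t^T *m M^T *m u = 0.
    by move=> u /M0[_ E]; rewrite trE E trmx0.
  by rewrite !colE.
split.
  apply: (kill_orthP _).2 ut => i j k.
  by rewrite ord1 !rowE; have [] := Mt j k.
apply: trmx_inj; rewrite -trE trmx0.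
apply: (kill_orthP _).2 ut => i j k.
by rewrite ord1 !colE; have [] := Mt j k.
Qed.

End SignVector.

(** * The cyclic shift and the two sign vectors *)

Lemma ordS_invariant_const (T : Type) n (f : 'I_n -> T) :
  (forall j, f (ordS j) = f j) -> forall j k, f j = f k.
Proof.
case: n f => [f _ []|n f fS] //.
suff f0 j : f j = f ord0 by move=> j k; rewrite !f0.
(* Climbing from [ord0] to [m.+1] stays below the bound, so the successor never wraps round. *)
case: j => m; elim: m => [|m IHm] lt_m; first by congr f; apply: val_inj.
rewrite -(IHm (ltnW lt_m)) -[RHS]fS; congr f; apply: val_inj.
by rewrite /= modn_small.
Qed.

Lemma ones_sq (R : realType) n (j : 'I_n) :
  ones j 0 * ones j 0 = 1 :> R.
Proof. by rewrite mxE mulr1. Qed.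

Lemma alt_sq (R : realType) n (j : 'I_n) : alt j 0 * alt j 0 = 1 :> R.
Proof. by rewrite mxE -expr2 sqrr_sign. Qed.

(** Reduction modulo an even number preserves parity, so the sign also flips when the last index
    wraps to the first. *)
Lemma alt_ordS (R : realType) n (j : 'I_n) :
  ~~ odd n -> alt (ordS j) 0 = - alt j 0 :> R.
Proof.
move=> n_even; rewrite !mxE -signr_odd odd_mod; last exact: negbTE.
by rewrite signr_odd exprS mulN1r.
Qed.

Lemma alt_neq0 (R : realType) n (j : 'I_n) : alt j 0 != 0 :> R.
Proof. by rewrite mxE signr_eq0. Qed.

(** * The exchange matrix and the hyperplane orthogonal to [ones] *)

Section Exchange.
Variables (R : realType) (n : nat).
Implicit Type M : 'M[R]_n.

Lemma mulmx_exchange m (A : 'M[R]_(m, n)) i j :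
  (A *m exchange_mx) i j = A i (rev_ord j).
Proof.
rewrite mxE (bigD1 (rev_ord j)) //= mxE eqxx mulr1 big1 ?addr0 // => k.
by rewrite mxE => /negPf ->; rewrite mulr0.
Qed.

Lemma exchange_mulmx m (A : 'M[R]_(n, m)) i j :
  (exchange_mx *m A) i j = A (rev_ord i) j.
Proof.
rewrite mxE (bigD1 (rev_ord i)) //= mxE rev_ordK eqxx mul1r big1 ?addr0 //.
move=> k; rewrite mxE -(inj_eq rev_ord_inj) rev_ordK eq_sym => /negPf ->.
by rewrite mul0r.
Qed.

Lemma exchange_conj M i j :
  (exchange_mx *m M *m exchange_mx) i j = M (rev_ord i) (rev_ord j).
Proof. by rewrite mulmx_exchange exchange_mulmx. Qed.

Lemma kill_orth_onesP m (A : 'M[R]_(m, n)) :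
  (forall u : 'cV[R]_n, orth [set ones] u -> A *m u = 0) <->
  (forall i j k, A i j = A i k).
Proof.
split=> [/(kill_orthP (@ones_sq R n)) E i j k|E].
  by have := E i j k; rewrite !mxE !mulr1.
by apply/(kill_orthP (@ones_sq R n)) => i j k; rewrite !mxE (E i j k).
Qed.

(** The columns of [M] are the images of the basis vectors and span the range, so it suffices that
    each column is constant. *)
Lemma col_range_onesP M :
  col_range M `<=` line ones <-> (forall i j k, M i j = M k j).
Proof.
split=> [sub i j k|E _ [x _ <-]].
  have [c _ /matrixP cE] : line ones (M *m delta_mx j 0).
    by apply: sub; exists (delta_mx j 0).
  have colE h : M h j = c.
    by have := cE h 0; rewrite -colE !mxE mulr1.
  by rewrite !colE.
case: (pickP (@predT 'I_n)) => [k _|n0]; last first.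
  by exists 0 => //; apply/matrixP => i; have := n0 i.
exists ((M *m x) k 0) => //; apply/matrixP => i o; rewrite ord1 !mxE mulr1.
by apply: eq_bigr => j _; rewrite (E i j k).
Qed.

(** The two matrices are transposes of each other, so constant rows of one are constant columns of
    the other. *)
Lemma kill_orth_col_range M :
  (forall u : 'cV[R]_n, orth [set ones] u ->
     (M + M *m exchange_mx) *m u = 0) <->
  col_range (M^T + exchange_mx *m M^T) `<=` line ones.
Proof.
have E i j :
    (M^T + exchange_mx *m M^T) i j = (M + M *m exchange_mx) j i.
  by rewrite mxE [RHS]mxE exchange_mulmx mulmx_exchange !mxE.
split=> [/kill_orth_onesP H|/col_range_onesP H].
  by apply/col_range_onesP => i j k; rewrite !E.
by apply/kill_orth_onesP => i j k; rewrite -!E.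
Qed.

End Exchange.

(** * Characterisations of the spaces S, R, V, M and N *)

Section Spaces.
Variables (R : realType) (n : nat) (M : 'M[R]_n).

(** [linear_orthP] makes the column sums all equal and the row sums all equal; that the two
    constants agree needs a separate argument. *)
Lemma space_SP :
  space_S M <->
  forall u : 'cV[R]_n, orth [set ones] u ->
    ones^T *m M *m u = 0 /\ u^T *m M *m ones = 0.
Proof.
have sumE (a : 'I_n -> R) :
    \sum_i (ones : 'cV[R]_n) i 0 * a i = \sum_i a i.
  by apply: eq_bigr => i _; rewrite mxE mul1r.
split=> [[w Mw]|/(linear_orthP (@ones_sq R n)) E].
  apply/(linear_orthP (@ones_sq R n)) => j k; rewrite !sumE !mxE !mulr1.
  by have [-> ->] := Mw j; have [-> ->] := Mw k.
have {}E j k : \sum_i M i j = \sum_i M i k /\ \sum_i M j i = \sum_i M k i.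
  by have := E j k; rewrite !sumE !mxE !mulr1.
case: (pickP (@predT 'I_n)) => [k _|n0]; last first.
  by exists 0 => i; have := n0 i.
have n_neq0 : n%:R != 0 :> R by rewrite pnatr_eq0 -lt0n (leq_trans _ (ltn_ord k)).
(* Double counting: [n] times either constant is the sum of all entries. *)
have rc : \sum_i M i k = \sum_i M k i.
  apply: (mulfI n_neq0); rewrite !mulr_natl.
  have const (a : R) : a *+ n = \sum_(i < n) a by rewrite sumr_const card_ord.
  rewrite !const (eq_bigr (fun j => \sum_i M i j)) => [|j _]; last first.
    by have [-> _] := E j k.
  by rewrite exchange_big; apply: eq_bigr => j _; have [_ ->] := E j k.
exists ((\sum_i M i k) / n%:R) => i; rewrite mulrCA divff // mulr1.
by have [-> ->] := E i k.
Qed.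

Lemma space_RP :
  space_R M <->
  (forall u : 'cV[R]_n, orth [set ones] u ->
     (M + M *m exchange_mx) *m u = 0) /\
  (forall u : 'cV[R]_n, orth [set ones] u ->
     (M^T + M^T *m exchange_mx) *m u = 0).
Proof.
have E (N : 'M[R]_n) i j :
    (N + N *m exchange_mx) i j = N i j + N i (rev_ord j).
  by rewrite mxE mulmx_exchange.
split=> [RM|[/kill_orth_onesP H /kill_orth_onesP H'] i j k].
  split; apply/kill_orth_onesP => i j k; rewrite !E.
    by have [] := RM i j k.
  by rewrite !mxE; have [] := RM j i k.
split; first by rewrite -!E.
by have := H' j i k; rewrite !E !mxE.
Qed.

(** For [t = ones] the bilinear criterion is the four-index identity rearranged. *)
Lemma space_VP :
  space_V M <->
  (forall u v : 'cV[R]_n, orth [set ones] u -> orth [set ones] v ->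
     u^T *m M *m v = 0) /\
  ones^T *m M *m (ones : 'cV[R]_n) = 0.
Proof.
have sumE : ((ones : 'cV[R]_n)^T *m M *m ones) 0 0 =
    \sum_i \sum_j M i j.
  rewrite quadratic_formE; apply: eq_bigr => i _; apply: eq_bigr => j _.
  by rewrite !mxE !mul1r.
split=> [[Mijkl M0]|[/(bilinear_orthP (@ones_sq R n)) E M0]].
  split; last by apply/matrixP => i j; rewrite !ord1 sumE M0 mxE.
  apply/(bilinear_orthP (@ones_sq R n)) => i j k l; rewrite !mxE !mulr1.
  by have := Mijkl i j k l; lra.
split; last by rewrite -sumE M0 mxE.
move=> i j k l.
by have := E i j k l; rewrite !mxE !mulr1; lra.
Qed.

Hypothesis n_even : ~~ odd n.

Lemma space_MP :
  space_M M <->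
  (forall u v : 'cV[R]_n, orth [set alt] u -> orth [set alt] v ->
     u^T *m M *m v = 0) /\
  alt^T *m M *m (alt : 'cV[R]_n) = 0.
Proof.
have sumE : ((alt : 'cV[R]_n)^T *m M *m alt) 0 0 =
    \sum_(i < n) \sum_(j < n) (-1) ^+ (i.+1 + j.+1) * M i j.
  rewrite quadratic_formE; apply: eq_bigr => i _; apply: eq_bigr => j _.
  (* Counting both indices from 1 adds two factors -1, which cancel. *)
  by rewrite !mxE -exprD addSn addnS !exprS !mulN1r opprK.
pose t (j : 'I_n) : R := alt j 0.
have tS j : t (ordS j) = - t j by apply: alt_ordS.
split=> [[M4 M0]|[/(bilinear_orthP (@alt_sq R n)) E M0]].
  split; last by apply/matrixP => i j; rewrite !ord1 sumE M0 mxE.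
  (* By the four-term relation the sum of two adjacent rows changes sign from one column to the
     next, as [t] does; the product is shift invariant. *)
  have colE i j l :
      (M i j + M (ordS i) j) * t j = (M i l + M (ordS i) l) * t l.
    move: j l; apply: ordS_invariant_const => j; rewrite tS.
    have -> : M i (ordS j) + M (ordS i) (ordS j) = - (M i j + M (ordS i) j).
      by have := M4 i j; lra.
    by rewrite mulrNN.
  apply/(bilinear_orthP (@alt_sq R n)) => i j k l; rewrite -/(t _).
  (* The same argument in the row index: by [colE] the difference of the two signed entries changes
     sign together with [t]. *)
  move: i k; apply: ordS_invariant_const => i; rewrite -!/(t _) tS.
  have -> : M (ordS i) j * t j - M (ordS i) l * t l =
      - (M i j * t j - M i l * t l) by have := colE i j l; lra.
  by rewrite mulrNN.
split; last by rewrite -sumE M0 mxE.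
(* At adjacent rows and columns the criterion is the four-term relation times [t i * t j], a nonzero
   factor. *)
move=> i j; have := E i j (ordS i) (ordS j); rewrite -!/(t _) !tS => E4.
apply: (mulIf (alt_neq0 R j)); apply: (mulIf (alt_neq0 R i)).
by rewrite -!/(t _); lra.
Qed.

Lemma space_NP :
  space_N M <->
  forall u : 'cV[R]_n, orth [set alt] u ->
    alt^T *m M *m u = 0 /\ u^T *m M *m alt = 0.
Proof.
(* The outer minus sign comes from [alt] starting with +1, whereas [(-1) ^+ i.+1] starts with -1. *)
have sumE (a b : 'I_n -> R) :
    \sum_(i < n) (-1) ^+ i.+1 * (a i + b i) =
    - (\sum_i (alt : 'cV[R]_n) i 0 * a i + \sum_i (alt : 'cV[R]_n) i 0 * b i).
  rewrite -big_split -sumrN; apply: eq_bigr => i _.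
  by rewrite mxE exprS mulN1r mulNr mulrDr.
(* Cancellation of neighbouring alternating sums [a] and [b] is one step of shift invariance, the
   sign passing from [t] to [- t]. *)
have stepE (a b t : R) : t != 0 -> (- (a + b) = 0 <-> b * - t = a * t).
  move=> t0; rewrite mulrN -mulNr; split=> [/eqP|/(mulIf t0) <-].
    by rewrite oppr_eq0 addr_eq0 => /eqP ->.
  by rewrite addNr oppr0.
split=> [NM|/(linear_orthP (@alt_sq R n)) E j].
  have invE : (forall j k, (\sum_i (alt : 'cV[R]_n) i 0 * M i j) * alt j 0 =
      (\sum_i (alt : 'cV[R]_n) i 0 * M i k) * alt k 0) /\
    (forall j k, (\sum_i (alt : 'cV[R]_n) i 0 * M j i) * alt j 0 =
      (\sum_i (alt : 'cV[R]_n) i 0 * M k i) * alt k 0).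
    split; apply: ordS_invariant_const => j; rewrite alt_ordS //;
      apply/(stepE _ _ _ (alt_neq0 R j)); rewrite -sumE;
      by have [] := NM j.
  by apply/(linear_orthP (@alt_sq R n)) => j k; split; apply invE.
have := E (ordS j) j; rewrite alt_ordS // !sumE => -[E1 E2].
by split; apply/(stepE _ _ _ (alt_neq0 R j)).
Qed.

End Spaces.

Theorem theorem1 (R : realType) (n : nat) (M : 'M[R]_n) :
  (* (a) *)
  (space_S M <->
     forall u : 'cV[R]_n, orth [set ones] u ->
       ones^T *m M *m u = 0 /\ u^T *m M *m ones = 0) /\
  (* (b) *)
  (space_A M <-> M + exchange_mx *m M *m exchange_mx = 0) /\
  (* (c) *)
  (space_B M <-> M = exchange_mx *m M *m exchange_mx) /\
  (* (d) *)
  ((space_R M <->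
      (forall u : 'cV[R]_n, orth [set ones] u ->
         (M + M *m exchange_mx) *m u = 0) /\
      (forall u : 'cV[R]_n, orth [set ones] u ->
         (M^T + M^T *m exchange_mx) *m u = 0)) /\
   ((forall u : 'cV[R]_n, orth [set ones] u ->
       (M + M *m exchange_mx) *m u = 0) <->
    col_range (M^T + exchange_mx *m M^T) `<=` line ones) /\
   ((forall u : 'cV[R]_n, orth [set ones] u ->
       (M^T + M^T *m exchange_mx) *m u = 0) <->
    col_range (M + exchange_mx *m M) `<=` line ones)) /\
  (* (e) *)
  (space_V M <->
     (forall u v : 'cV[R]_n, orth [set ones] u -> orth [set ones] v ->
        u^T *m M *m v = 0) /\
     ones^T *m M *m (ones : 'cV[R]_n) = 0) /\
  (* (f) *)
  (~~ odd n ->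
   (space_M M <->
      (forall u v : 'cV[R]_n, orth [set alt] u -> orth [set alt] v ->
         u^T *m M *m v = 0) /\
      alt^T *m M *m (alt : 'cV[R]_n) = 0)) /\
  (* (g) *)
  (~~ odd n ->
   (space_N M <->
      forall u : 'cV[R]_n, orth [set alt] u ->
        alt^T *m M *m u = 0 /\ u^T *m M *m alt = 0)).
Proof.
split; first exact: space_SP.
split.
  split=> [AM|/matrixP E i j].
    by apply/matrixP => i j; rewrite mxE exchange_conj mxE AM.
  by have := E i j; rewrite mxE exchange_conj mxE.
split.
  split=> [BM|E i j].
    by apply/matrixP => i j; apply/eqP; rewrite exchange_conj -subr_eq0 BM.
  by rewrite {1}E exchange_conj subrr.
split.
  split; first exact: space_RP.
  split; first exact: kill_orth_col_range.
  (* The second equivalence of (d) is the first one for the transpose. *)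
  by have := kill_orth_col_range M^T; rewrite trmxK.
split; first exact: space_VP.
split=> n_even; first exact: space_MP.
exact: space_NP.
Qed.
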